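(* Let $P=(X,\prec)$ be a finite poset, and let $A,B\subset\min(P)$ be disjoint nonempty subsets of minimal elements. Let $f$ be a uniformly random linear extension of $P$ and $f(S):=\{f(s):s\in S\}$ for $S\subseteq X$. Then $$\mathbb{P}\big[1\in f(A),\,2\in f(B)\big]^2\ \ge\ \mathbb{P}\big[1\in f(A),\,2\in f(A{\uparrow})\big]\cdot\mathbb{P}\big[1\in f(B),\,2\in f(B{\uparrow})\big].$$
   Context: A linear extension of a poset $P=(X,\prec)$ with $|X|=n$ is a bijection $f:X\to\{1,\dots,n\}$ such that $u\prec v$ implies $f(u)<f(v)$. Probabilities are with respect to the uniform distribution on linear extensions of $P$. $\min(P)$ is the set of minimal elements of $P$. For $S\subseteq X$, the upper closure is $S{\uparrow}:=\{u\in X:\ u\succcurlyeq s\text{ for some } s\in S\}$. *)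

(* Defs.v *)
From HB Require Import structures.
From mathcomp Require Import all_boot all_order all_algebra.

Set Implicit Arguments.
Unset Strict Implicit.
Unset Printing Implicit Defensive.

Import Order.TTheory GRing.Theory Num.Theory.

Section LinearExtensions.

Context {d : Order.disp_t} {X : finPOrderType d}.

(* The target {1, ..., n} is encoded as 'I_n with n = #|X|; the ordinal k
   stands for the label k + 1, see flabels. *)
Definition labelling := {ffun X -> 'I_#|X|}.

Definition is_linext (f : labelling) : bool :=
  [&& injectiveb f,
      [forall k : 'I_#|X|, exists x : X, f x == k]
    & [forall u : X, forall v : X, (u < v)%O ==> (f u < f v)%N]].

Definition linexts : {set labelling} := [set f | is_linext f].

Definition Pr (E : pred labelling) : rat :=
  (#|[set f in linexts | E f]|%:R / #|linexts|%:R)%R.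

Definition minimals : {set X} := [set x | [forall y : X, ~~ (y < x)%O]].

Definition up_closure (S : {set X}) : {set X} :=
  [set u | [exists s in S, (s <= u)%O]].

(* The image f(S), as a list of natural numbers in {1, ..., n}. *)
Definition flabels (f : labelling) (S : {set X}) : seq nat :=
  [seq (f s).+1 | s in S].

End LinearExtensions.

Arguments labelling {d} X.
Arguments linexts {d} X.
Arguments minimals {d} X.

(* Main.v *)
Require Import Defs.
From mathcomp Require Import all_boot all_order all_algebra.
From mathcomp Require Import ring lra.

(** For a finite poset, let M be the symmetric matrix indexed by the minimal
    elements whose (x, y) entry counts the linear extensions that start with x
    and then y if x <> y, and those that start with x and then a nonminimal
    element (necessarily above x) if x = y. The three probabilities are, up to
    normalisation, the values of the quadratic form of M at the indicator
    vectors of A and B, so the theorem is a reverse Cauchy-Schwarz inequality: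
    M has to be negative semidefinite on the M-orthogonal of the vector 1.

    This is shown by induction on the poset P, in the manner of the
    combinatorial atlases of Chan and Pak. Deleting a minimal element x gives
    the matrix M^x of P - x and a map T_x of weights, with (M v)_x =
    <T_x v, M^x 1> and <v, M v> <= sum_x <T_x v, M^x T_x v>. The induction
    hypothesis for P - x then yields <v, M v> <= sum_x (M v)_x^2 / d_x, where
    d = M 1. In terms of the weighted graph Laplacian L = diag(d) - M, this
    says that <w, L w> <= sum_x (L w)_x^2 / d_x for all w; if v is orthogonal
    to d, solving L w = d v and expanding <v - w, L (v - w)> >= 0 gives
    <v, M v> <= 0. *)

Set Implicit Arguments.
Unset Strict Implicit.
Unset Printing Implicit Defensive.

Import Order.TTheory GRing.Theory Num.Theory.

Local Open Scope ring_scope.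

(** * Weighted graph Laplacians and the local-to-global principle *)

Section LocalToGlobal.

Lemma injective_system_solvable (F : fieldType) (T : finType)
    (G : T -> T -> F) (b : T -> F) :
    (forall w : T -> F, (forall x, \sum_y G x y * w y = 0) ->
       forall x, w x = 0) ->
  exists w : T -> F, forall x, \sum_y G x y * w y = b x.
Proof.
move=> injG.
(* [N] is the transpose of [G], because vectors are rows acting from the left. *)
pose N : 'M[F]_#|T| := \matrix_(i, j) G (enum_val j) (enum_val i).
have mulN (u : 'rV[F]_#|T|) x :
    (u *m N) 0 (enum_rank x) = \sum_y G x y * u 0 (enum_rank y).
  rewrite mxE (reindex (@enum_rank T)) /=; last first.
    by apply: onW_bij; apply: enum_rank_bij.
  by apply: eq_bigr => y _; rewrite mxE !enum_rankK mulrC.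
have unitN : N \in unitmx.
  rewrite -row_free_unit; apply/inj_row_free => u uN0.
  apply/rowP => j; rewrite mxE -(enum_valK j).
  apply: (injG (fun x => u 0 (enum_rank x))) => x.
  by rewrite -mulN uN0 mxE.
pose u : 'rV[F]_#|T| := (\row_j b (enum_val j)) *m invmx N.
exists (fun x => u 0 (enum_rank x)) => x.
by rewrite -mulN mulmxKV // mxE enum_rankK.
Qed.

Variables (R : realFieldType) (T : finType) (S : {set T}) (m : T -> T -> R).

Let M (v : T -> R) x := \sum_(y in S) m x y * v y.
Let deg x := \sum_(y in S) m x y.
Let L (v : T -> R) x := deg x * v x - M v x.

Hypothesis mC : forall x y, x \in S -> y \in S -> m x y = m y x.
Hypothesis m_ge0 : forall x y, x \in S -> y \in S -> 0 <= m x y.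
Hypothesis m_gt0 : forall x y, x \in S -> y \in S -> x != y -> 0 < m x y.
Hypothesis deg_gt0 : forall x, x \in S -> 0 < deg x.

Lemma sym_form (v w : T -> R) :
  \sum_(x in S) v x * M w x = \sum_(x in S) w x * M v x.
Proof.
under eq_bigr do rewrite mulr_sumr.
under [RHS]eq_bigr do rewrite mulr_sumr.
rewrite exchange_big /=; apply: eq_bigr => y yS; apply: eq_bigr => x xS.
by rewrite (mC xS yS); ring.
Qed.

Lemma sym_laplacian (v w : T -> R) :
  \sum_(x in S) v x * L w x = \sum_(x in S) w x * L v x.
Proof.
under eq_bigr do rewrite /L mulrBr.
under [RHS]eq_bigr do rewrite /L mulrBr.
rewrite !sumrB sym_form; congr (_ - _).
by apply: eq_bigr => x _; ring.
Qed.

(** The energy is the sum of [m x y * (v x * (v x - v y))]; adding a second copy with [x] and [y]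
    exchanged produces the squares. *)
Lemma laplacian_dirichlet (v : T -> R) :
  (\sum_(x in S) v x * L v x) *+ 2 =
  \sum_(x in S) \sum_(y in S) m x y * (v x - v y) ^+ 2.
Proof.
have E x : x \in S -> v x * L v x =
    \sum_(y in S) m x y * (v x * (v x - v y)).
  move=> xS; rewrite /L /deg /M mulr_suml -sumrB mulr_sumr.
  by apply: eq_bigr => y _; ring.
rewrite mulr2n {1}(eq_bigr _ E) (eq_bigr _ E) [X in X + _]exchange_big /=.
rewrite -big_split /=; apply: eq_bigr => x xS.
rewrite -big_split /=; apply: eq_bigr => y yS.
by rewrite (mC yS xS); ring.
Qed.

Lemma laplacian_ge0 (v : T -> R) : 0 <= \sum_(x in S) v x * L v x.
Proof.
rewrite -(pmulrn_lge0 _ (isT : (0 < 2)%N)) laplacian_dirichlet.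
apply: sumr_ge0 => x xS; apply: sumr_ge0 => y yS.
by rewrite mulr_ge0 ?m_ge0 ?sqr_ge0.
Qed.

(** Every Dirichlet term vanishes, and any two distinct vertices are joined by an edge of positive
    weight. *)
Lemma laplacian_kernel_const (v : T -> R) :
    \sum_(x in S) v x * L v x = 0 ->
  forall x y, x \in S -> y \in S -> v x = v y.
Proof.
move=> v0 x y xS yS; apply/eqP; case: (eqVneq x y) => [->//|nxy].
have := laplacian_dirichlet v; rewrite v0 mul0rn => /esym /eqP.
have ge0 x' y' : x' \in S -> y' \in S -> 0 <= m x' y' * (v x' - v y') ^+ 2.
  by move=> ? ?; rewrite mulr_ge0 ?m_ge0 ?sqr_ge0.
rewrite psumr_eq0; last by move=> ? ?; apply: sumr_ge0 => ? ?; apply: ge0.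
move/allP/(_ x (mem_index_enum x)); rewrite xS /=.
rewrite psumr_eq0; last by move=> ? ?; apply: ge0.
move/allP/(_ y (mem_index_enum y)); rewrite yS /=.
by rewrite mulf_eq0 gt_eqF ?m_gt0 //= sqrf_eq0 subr_eq0.
Qed.

Lemma sum_laplacian (v : T -> R) : \sum_(x in S) L v x = 0.
Proof.
have -> : \sum_(x in S) L v x = \sum_(x in S) 1 * L v x.
  by apply: eq_bigr => x _; rewrite mul1r.
rewrite (sym_laplacian (fun=> 1)) big1 // => x _.
by rewrite /L /M /deg; under [X in _ - X]eq_bigr do rewrite mulr1;
  rewrite mulr1 subrr mulr0.
Qed.

(* The Laplacian plus the all-ones matrix is nonsingular, and it agrees with
   the Laplacian on every solution because [b] has zero sum. *)
Lemma laplacian_solve (b : T -> R) : \sum_(x in S) b x = 0 ->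
  exists w : T -> R, forall x, x \in S -> L w x = b x.
Proof.
move=> b0.
have [->|[x0 x0S]] := set_0Vmem S; first by exists (fun=> 0) => x; rewrite inE.
(* Outside [S] the matrix is the identity, which makes the system square over all of [T] without
   affecting [S]. *)
pose G x y := if x \in S then
    (if y \in S then (if y == x then deg x else 0) - m x y + 1 else 0)
  else (x == y)%:R.
have GS x w : x \in S -> \sum_y G x y * w y = L w x + \sum_(y in S) w y.
  move=> xS; rewrite (bigID (mem S)) /= [X in _ + X]big1 ?addr0; last first.
    by move=> y /negbTE yS; rewrite /G xS yS mul0r.
  rewrite /L /M [deg x * _](_ : _ =
      \sum_(y in S) (if y == x then deg x else 0) * w y); last first.
    rewrite (bigD1 x) //= eqxx big1 ?addr0 // => y /andP[_ /negbTE->].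
    by rewrite mul0r.
  rewrite -sumrB -big_split /=; apply: eq_bigr => y yS.
  by rewrite /G xS yS; set c := (if _ then _ else _); ring.
(* Summing the equations over [S] kills the Laplacian and leaves [#|S|] times the sum of [w]. *)
have Gsum w c : (forall x, x \in S -> \sum_y G x y * w y = c x) ->
    \sum_(x in S) c x = 0 -> \sum_(y in S) w y = 0.
  move=> Gw; rewrite -(eq_bigr _ Gw) (eq_bigr _ (fun x => @GS x w)).
  rewrite big_split /= sum_laplacian add0r sumr_const => /eqP.
  by rewrite mulrn_eq0 cards_eq0 => /orP[/eqP S0|/eqP//]; move: x0S; rewrite S0 inE.
have GN x w : x \notin S -> \sum_y G x y * w y = w x.
  move=> /negbTE xS; rewrite (bigD1 x) //= /G xS eqxx mul1r big1 ?addr0 //.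
  by move=> y; rewrite eq_sym => /negbTE->; rewrite mul0r.
have injG w : (forall x, \sum_y G x y * w y = 0) -> forall x, w x = 0.
  move=> Gw x; case: (boolP (x \in S)) => [xS|xS]; last by rewrite -(GN x w xS).
  have w0 : \sum_(y in S) w y = 0.
    by apply: (@Gsum w (fun=> 0)) => [y _|]; [apply: Gw | rewrite big1].
  have Lw y : y \in S -> L w y = 0.
    by move=> yS; have := GS y w yS; rewrite Gw w0 addr0.
  have wc := @laplacian_kernel_const w.
  have {}wc : forall y, y \in S -> w y = w x.
    move=> y yS; apply: wc => //; apply: big1 => z zS; by rewrite Lw // mulr0.
  move: w0; rewrite (eq_bigr _ wc) sumr_const => /eqP.
  by rewrite mulrn_eq0 cards_eq0 => /orP[/eqP S0|/eqP//]; move: xS; rewrite S0 inE.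
have [w Gw] := @injective_system_solvable _ _ G b injG.
exists w => x xS; have := GS x w xS.
by rewrite Gw (@Gsum w b) ?addr0 // => *; rewrite Gw.
Qed.

(* With [L w = deg * v], the hypothesis bounds the energy of [w] by
   [p = \sum deg * v ^+ 2], and positivity of the energy of [v - w] then
   bounds the energy of [v], which is [p - \sum v * M v], below by [p]. *)
Lemma local_global :
    (forall v : T -> R, \sum_(x in S) v x * M v x <=
       \sum_(x in S) (M v x) ^+ 2 / deg x) ->
  forall v : T -> R, \sum_(x in S) deg x * v x = 0 ->
    \sum_(x in S) v x * M v x <= 0.
Proof.
move=> loc v v0; have [w Lw] := laplacian_solve v0.
set p := \sum_(x in S) deg x * v x ^+ 2.
have vLw : \sum_(x in S) v x * L w x = p.
  by apply: eq_bigr => x xS; rewrite Lw //; ring.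
have vLv : \sum_(x in S) v x * L v x = p - \sum_(x in S) v x * M v x.
  by rewrite -sumrB; apply: eq_bigr => x xS; rewrite /L; ring.
have wLw : \sum_(x in S) w x * L w x <= p.
  (* Since [v x = L w x / deg x], this expands [(deg x * w x - M w x) ^+ 2 / deg x]; the bracket has
     nonnegative sum by [loc]. *)
  have -> : p = \sum_(x in S) (w x * L w x +
      ((M w x) ^+ 2 / deg x - w x * M w x)).
    apply: eq_bigr => x xS; have dx := lt0r_neq0 (deg_gt0 xS).
    have -> : v x = L w x / deg x by rewrite Lw //; field.
    by rewrite /L; field.
  by rewrite big_split /= sumrB; have := loc w; lra.
have := laplacian_ge0 (fun x => v x - w x).
have -> : \sum_(x in S) (v x - w x) * L (fun x => v x - w x) x =
   \sum_(x in S) v x * L v x - \sum_(x in S) v x * L w x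
   - (\sum_(x in S) w x * L v x - \sum_(x in S) w x * L w x).
  rewrite -!sumrB; apply: eq_bigr => x xS.
  have -> : L (fun x => v x - w x) x = L v x - L w x.
    rewrite /L /M; under eq_bigr do rewrite mulrBr.
    by rewrite sumrB; ring.
  by ring.
rewrite (sym_laplacian w v) vLw vLv; lra.
Qed.

End LocalToGlobal.

(** Renaming variables shows that the six-term sum totals six times the original one. *)
Lemma sum3_sym_ge0 (R : realFieldType) (T : finType) (H : T -> T -> T -> R) :
    (forall x y z, 0 <= H x y z + H x z y + H y x z + H y z x
                        + H z x y + H z y x) ->
  0 <= \sum_x \sum_y \sum_z H x y z.
Proof.
move=> symH; set s := \sum_x _.
have swap23 (G : T -> T -> T -> R) :
    \sum_x \sum_y \sum_z G x z y = \sum_x \sum_y \sum_z G x y z.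
  by apply: eq_bigr => x _; rewrite exchange_big.
have swap12 (G : T -> T -> T -> R) :
    \sum_x \sum_y \sum_z G y x z = \sum_x \sum_y \sum_z G x y z.
  by rewrite exchange_big.
have : 0 <= \sum_x \sum_y \sum_z (H x y z + H x z y + H y x z + H y z x
                                + H z x y + H z y x).
  by do 3![apply: sumr_ge0 => ? _].
under eq_bigr do under eq_bigr do rewrite !big_split /=.
under eq_bigr do rewrite !big_split /=.
rewrite !big_split /= -/s.
have -> : \sum_x \sum_y \sum_z H x z y = s by rewrite (swap23 H).
have -> : \sum_x \sum_y \sum_z H y x z = s by rewrite (swap12 H).
have -> : \sum_x \sum_y \sum_z H y z x = s.
  by rewrite (swap12 (fun x y z => H x z y)) (swap23 H).
have -> : \sum_x \sum_y \sum_z H z x y = s.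
  by rewrite (swap23 (fun x y z => H y x z)) (swap12 H).
have -> : \sum_x \sum_y \sum_z H z y x = s.
  by rewrite (swap23 (fun x y z => H y z x)) (swap12 (fun x y z => H x z y))
             (swap23 H).
by lra.
Qed.

(** * The quadratic form attached to a subset of the poset *)

Section Forms.

Context {d : Order.disp_t} {X : finPOrderType d}.
Implicit Types (U : {set X}) (x y z : X) (v w : X -> rat).

Definition mins U : {set X} := [set x in U | [forall y in U, ~~ (y < x)%O]].

(* [nlin_rec #|U| U] is the number of linear extensions of the order induced
   on [U]; the first argument is fuel. *)
Fixpoint nlin_rec n U : nat :=
  if n is n'.+1 then \sum_(x in mins U) nlin_rec n' (U :\ x) else 1.

Definition nlin U : nat := nlin_rec #|U| U.

(* Transports a weight on the minimal elements of [U] to those of [U :\ x]: the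
   newly minimal ones are above [x] and inherit its weight. *)
Definition pull U x v y : rat := if y \in mins U then v y else v x.

Definition adjop U v x : rat :=
  \sum_(y in mins (U :\ x)) (nlin (U :\ x :\ y))%:R * pull U x v y.

(* The sum over linear extensions of the induced order on [U] of
   [v x * w y'], where [x] is the first element, and [y'] is the second one if
   it is minimal and [x] otherwise. *)
Definition sform U v w : rat := \sum_(x in mins U) v x * adjop U w x.

Definition adj U x y : rat :=
  if y == x then \sum_(z in mins (U :\ x) | z \notin mins U) (nlin (U :\ x :\ z))%:R
  else (nlin (U :\ x :\ y))%:R.

Lemma minsP U x :
  reflect (x \in U /\ forall y, y \in U -> ~~ (y < x)%O) (x \in mins U).
Proof.
rewrite inE; apply: (iffP andP) => -[xU].
  by move/forall_inP.
by move=> H; split=> //; apply/forall_inP.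
Qed.

Lemma mins_sub U : mins U \subset U.
Proof. by apply/subsetP => x /minsP[]. Qed.

Lemma mins_nonempty U : U != set0 -> exists x, x \in mins U.
Proof.
case/set0Pn => x0; have [n] := ubnP #|[set y in U | (y < x0)%O]|.
elim: n x0 => // n IHn x0 lt_n x0U.
case: (boolP (x0 \in mins U)) => [|nmin]; first by exists x0.
move: nmin; rewrite inE x0U /= negb_forall_in => /existsP[y /andP[yU]].
rewrite negbK => ltyx; apply: (IHn y) => //.
rewrite -ltnS; apply: leq_trans lt_n; rewrite ltnS; apply: proper_card; apply/properP; split.
  by apply/subsetP => z; rewrite !inE => /andP[-> /lt_trans->].
by exists y; rewrite !inE yU ?ltyx ?ltxx.
Qed.

Lemma nlin_mins U : U != set0 -> nlin U = \sum_(x in mins U) nlin (U :\ x).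
Proof.
move=> U0; rewrite /nlin; have [n cU] : exists n, #|U| = n.+1.
  by move: U0; rewrite -card_gt0; case: #|U| => // n _; exists n.
rewrite cU /=; apply: eq_bigr => x xm; congr nlin_rec.
have := cardsD1 x U; rewrite cU (subsetP (mins_sub U) _ xm).
by rewrite add1n => -[].
Qed.

Lemma nlin_gt0 U : (0 < nlin U)%N.
Proof.
have [n] := ubnP #|U|; elim: n U => // n IHn U ltU.
case: (eqVneq U set0) => [->|U0]; first by rewrite /nlin cards0.
have [x xm] := mins_nonempty U0; have xU := subsetP (mins_sub U) _ xm.
rewrite nlin_mins // (bigD1 x) //= ltn_addr // IHn //.
by rewrite -ltnS (leq_trans _ ltU) // [in X in (_ < X)%N](cardsD1 x) xU.
Qed.

Lemma mins_setD1 U x y : x \in mins U ->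
  (y \in mins (U :\ x)) && (y \in mins U) = (y \in mins U) && (y != x).
Proof.
move=> xm; rewrite andbC; case: (boolP (y \in mins U)) => //= /minsP[yU ym].
apply/minsP/idP => [[]|nyx]; first by rewrite !inE => /andP[].
by rewrite !inE nyx; split=> // z; rewrite !inE => /andP[_ /ym].
Qed.

(** Second elements that are only minimal once [x] is gone carry the weight [v x] and make up the
    diagonal entry; the others give the off-diagonal ones. *)
Lemma adjopE U v x : x \in mins U ->
  adjop U v x = \sum_(y in mins U) adj U x y * v y.
Proof.
move=> xm; rewrite /adjop (bigID (mem (mins U))) /= addrC.
rewrite [RHS](bigD1 x) //= {1}/adj eqxx mulr_suml; congr (_ + _).
  by apply: eq_bigr => y /andP[_ /negbTE ym]; rewrite /pull ym.
under eq_bigl do rewrite mins_setD1 //.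
by apply: eq_bigr => y /andP[ym /negbTE nyx]; rewrite /pull /adj ym nyx.
Qed.

Lemma adjC U x y : adj U x y = adj U y x.
Proof.
rewrite /adj eq_sym; case: (eqVneq x y) => [->//|_].
by rewrite !setDDl setUC.
Qed.

Lemma adj_ge0 U x y : 0 <= adj U x y.
Proof. by rewrite /adj; case: ifP => _ //; apply: sumr_ge0. Qed.

Lemma sformE U v w : sform U v w =
  \sum_(x in mins U) v x * \sum_(y in mins U) adj U x y * w y.
Proof. by apply: eq_bigr => x xm; rewrite adjopE. Qed.

Lemma sformC U v w : sform U v w = sform U w v.
Proof. by rewrite !sformE; apply: sym_form => x y _ _; apply: adjC. Qed.

Lemma sform_linear U (a b : rat) v v' w :
  sform U (fun x => a * v x + b * v' x) w = a * sform U v w + b * sform U v' w.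
Proof.
by rewrite /sform !mulr_sumr -big_split /=; apply: eq_bigr => x _; ring.
Qed.

(** For a constant weight, [pull] changes nothing and the recursion for [nlin] remains. It fails at
    [set0], where the sum is empty but [nlin] is 1. *)
Lemma adjop1 U x : U :\ x != set0 -> adjop U (fun=> 1) x = (nlin (U :\ x))%:R.
Proof.
move=> U0; rewrite nlin_mins // natr_sum.
by apply: eq_bigr => y _; rewrite /pull if_same mulr1.
Qed.

Lemma sform11 U : (1 < #|U|)%N -> sform U (fun=> 1) (fun=> 1) = (nlin U)%:R.
Proof.
move=> U1; have U0 : U != set0 by rewrite -card_gt0 ltnW.
rewrite nlin_mins // natr_sum; apply: eq_bigr => x xm.
rewrite mul1r adjop1 // -card_gt0.
have := cardsD1 x U; rewrite (subsetP (mins_sub U) _ xm) => E.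
by move: U1; rewrite E.
Qed.

(** * The local inequality, by symmetrisation over triples *)

(* [x], [y], [z] are distinct and every element of [U] below one of them is one
   of them: exactly then some ordering of them starts a linear extension. *)
Let closed3 U x y z :=
  [/\ [&& x \in U, y \in U & z \in U], [&& x != y, x != z & y != z]
    & forall u t, u \in U -> t \in [:: x; y; z] -> (u < t)%O ->
        u \in [:: x; y; z]].

Lemma closed3_swap12 U x y z : closed3 U x y z -> closed3 U y x z.
Proof.
case=> /and3P[xU yU zU] /and3P[xy xz yz] cl; split; first by rewrite xU yU zU.
  by rewrite eq_sym xy xz yz.
have E s : (s \in [:: y; x; z]) = (s \in [:: x; y; z]).
  by rewrite !inE orbCA.
by move=> u t; rewrite !E; apply: cl.
Qed.

Lemma closed3_swap23 U x y z : closed3 U x y z -> closed3 U x z y.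
Proof.
case=> /and3P[xU yU zU] /and3P[xy xz yz] cl; split; first by rewrite xU yU zU.
  by rewrite xy xz eq_sym yz.
have E s : (s \in [:: x; z; y]) = (s \in [:: x; y; z]).
  by rewrite !inE [(s == z) || _]orbC.
by move=> u t; rewrite !E; apply: cl.
Qed.

(** With the two lemmas that follow, this reduces minimality at each deletion stage to comparisons
    inside the triple. *)
Lemma mins_closed3 U x y z : closed3 U x y z ->
  (x \in mins U) = ~~ (y < x)%O && ~~ (z < x)%O.
Proof.
case=> /and3P[xU yU zU] _ cl; apply/minsP/andP => [[_ xm]|[yx zx]].
  by rewrite !xm.
split=> // u uU; apply/negP => ux; have := cl u x uU (mem_head _ _) ux.
by rewrite !inE => /or3P[] /eqP E; move: ux yx zx; rewrite E ?ltxx // => ->.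
Qed.

Lemma mins_closed3_D1 U x y z : closed3 U x y z ->
  (y \in mins (U :\ x)) = ~~ (z < y)%O.
Proof.
case=> /and3P[xU yU zU] /and3P[xy xz yz] cl.
apply/minsP/idP => [[_ ym]|zy]; first by rewrite ym // !inE eq_sym xz.
rewrite !inE eq_sym xy; split=> // u; rewrite !inE => /andP[ux uU].
apply/negP => uy; have := cl u y uU; rewrite !inE eqxx orbT => /(_ isT uy).
by rewrite (negbTE ux) /= => /orP[] /eqP E; move: uy zy; rewrite E ?ltxx // => ->.
Qed.

Lemma mins_closed3_D2 U x y z : closed3 U x y z -> z \in mins (U :\ x :\ y).
Proof.
case=> /and3P[xU yU zU] /and3P[xy xz yz] cl.
apply/minsP; rewrite !inE eq_sym yz eq_sym xz; split=> // u.
rewrite !inE => /and3P[uy ux uU].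
apply/negP => uz; have := cl u z uU; rewrite !inE eqxx !orbT => /(_ isT uz).
by rewrite (negbTE ux) (negbTE uy) /= => /eqP E; move: uz; rewrite E ltxx.
Qed.

Lemma closed3_intro U x y z :
    [&& x \in mins U, y \in mins (U :\ x) & z \in mins (U :\ x :\ y)] ->
  closed3 U x y z.
Proof.
case/and3P => /minsP[xU xm] /minsP[].
rewrite in_setD1 => /andP[yx yU] ym /minsP[].
rewrite !in_setD1 => /and3P[zy zx zU] zm; split; first by rewrite xU yU zU.
  by rewrite eq_sym yx eq_sym zx eq_sym zy.
move=> u t uU; rewrite !inE => tin ut.
apply: contraTT ut; rewrite !negb_or => /and3P[ux uy uz].
case/or3P: tin => /eqP->; first exact: xm.
  by apply: ym; rewrite !inE ux.
by apply: zm; rewrite !inE uy ux.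
Qed.

(* Symmetrising over the orders of the first three elements, the difference of
   the two sides is a sum of squares [(v x - v y) ^+ 2], over the triples in
   which the minimal elements [x], [y] are both below the third one. *)
Lemma sform_pull U v : (2 < #|U|)%N ->
  sform U v v <= \sum_(x in mins U) sform (U :\ x) (pull U x v) (pull U x v).
Proof.
move=> U2.
have cardD U' x k : (k.+1 < #|U'|)%N -> (k < #|U' :\ x|)%N.
  by rewrite (cardsD1 x U'); case: (x \in U') => // /ltnW.
rewrite -subr_ge0 /sform -sumrB.
pose valid x y z := [&& x \in mins U, y \in mins (U :\ x) & z \in mins (U :\ x :\ y)].
(* The contribution of the initial segment [x], [y], [z] to the right side minus that to the left
   side. *)
pose wt x y z := pull U x v y * pull (U :\ x) y (pull U x v) z - v x * pull U x v y.
pose H x y z := if valid x y z then (nlin (U :\ x :\ y :\ z))%:R * wt x y z else 0.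
rewrite (_ : \sum_(x in mins U) _ = \sum_x \sum_y \sum_z H x y z).
  apply: sum3_sym_ge0 => x y z.
  case: (boolP [|| valid x y z, valid x z y, valid y x z, valid y z x,
                   valid z x y | valid z y x]); last first.
    by rewrite !negb_or /H => /and5P[/negbTE-> /negbTE-> /negbTE-> /negbTE->
      /andP[/negbTE-> /negbTE->]]; rewrite !addr0.
  move=> some_valid; have cxyz : closed3 U x y z.
    case/orP: some_valid => [/closed3_intro//|].
    case/orP => [/closed3_intro/closed3_swap23//|].
    case/orP => [/closed3_intro/closed3_swap12//|].
    case/orP => [/closed3_intro/closed3_swap23/closed3_swap12//|].
    case/orP => [/closed3_intro/closed3_swap12/closed3_swap23//|].
    by move/closed3_intro/closed3_swap12/closed3_swap23/closed3_swap12.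
  pose g : rat := (nlin (U :\ x :\ y :\ z))%:R.
  (* [H] with weights and comparisons abstracted: [ab] stands for first below second, and so on;
     [b'] and [c'] are the transported weights of the second and third elements. *)
  pose order3 (a b c : rat) (ab ba ac ca bc cb : bool) : rat :=
    if ~~ ba && ~~ ca && ~~ cb then
      let b' := if ~~ ab && ~~ cb then b else a in
      let c' := if ~~ bc then if ~~ ac && ~~ bc then c else a else b' in
      b' * c' - a * b'
    else 0.
  have HE a b c : closed3 U a b c -> U :\ a :\ b :\ c = U :\ x :\ y :\ z ->
      H a b c = g * order3 (v a) (v b) (v c) (a < b)%O (b < a)%O (a < c)%O
                      (c < a)%O (b < c)%O (c < b)%O.
    move=> cabc EU; have cbac := closed3_swap12 cabc.
    have ccab := closed3_swap12 (closed3_swap23 cabc).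
    rewrite /H /valid /wt /pull EU (mins_closed3 cabc) (mins_closed3_D1 cabc).
    rewrite (mins_closed3_D2 cabc) (mins_closed3 cbac) (mins_closed3 ccab).
    rewrite (mins_closed3_D1 (closed3_swap23 cabc)) andbT -andbA.
    by rewrite /order3 -andbA; case: ifP; rewrite ?mulr0.
  have cxzy := closed3_swap23 cxyz; have cyxz := closed3_swap12 cxyz.
  have cyzx := closed3_swap23 cyxz; have czxy := closed3_swap12 cxzy.
  have czyx := closed3_swap23 czxy.
  have EU a b c : [set a; b; c] = [set x; y; z] ->
      U :\ a :\ b :\ c = U :\ x :\ y :\ z.
    by rewrite !setDDl !setUA => ->.
  rewrite (HE x y z) //; do 5![rewrite HE //; last by apply: EU; apply/setP => t; rewrite !inE;
    do 3!case: (t == _)].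
  rewrite -!mulrDr mulr_ge0 //.
  (* Asymmetry and transitivity discard the impossible patterns among the 64; the three squares
     settle the rest. *)
  have : [&& ~~ ((x < y)%O && (y < x)%O), ~~ ((x < z)%O && (z < x)%O)
            & ~~ ((y < z)%O && (z < y)%O)].
    by apply/and3P; split; apply/negP => /andP[/lt_trans h /h]; rewrite ltxx.
  have : [&& (x < y)%O && (y < z)%O ==> (x < z)%O,
             (x < z)%O && (z < y)%O ==> (x < y)%O,
             (y < x)%O && (x < z)%O ==> (y < z)%O,
             (y < z)%O && (z < x)%O ==> (y < x)%O,
             (z < x)%O && (x < y)%O ==> (z < y)%O
           & (z < y)%O && (y < x)%O ==> (z < x)%O].
    by do 5?[apply/andP; split]; apply/implyP => /andP[h /(lt_trans h)].
  have := sqr_ge0 (v x - v y); have := sqr_ge0 (v x - v z).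
  have := sqr_ge0 (v y - v z).
  move: (v x) (v y) (v z) => a b c.
  rewrite /order3; case: (x < y)%O; case: (y < x)%O; case: (x < z)%O;
  case: (z < x)%O; case: (y < z)%O; case: (z < y)%O => //=; lra.
rewrite [LHS]big_mkcond; apply: eq_bigr => x _; case: ifP => xm; last first.
  by rewrite big1 // => y _; rewrite big1 // => z _; rewrite /H /valid xm.
rewrite mulr_sumr -sumrB [LHS]big_mkcond; apply: eq_bigr => y _.
case: ifP => ym; last by rewrite big1 // => z _; rewrite /H /valid xm ym.
(* Splitting the left side by its third element requires one to exist, hence [2 < #|U|]. *)
rewrite nlin_mins; last by rewrite -card_gt0 !cardD.
rewrite natr_sum mulr_suml /adjop !mulr_sumr -sumrB [LHS]big_mkcond.
apply: eq_bigr => z _; rewrite /H /valid xm ym /=; case: ifP => // _.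
by rewrite /wt; ring.
Qed.

(** * Hyperbolicity of the form, by induction on cardinality *)

Lemma sform_card_le1 U v w : (#|U| <= 1)%N -> sform U v w = 0.
Proof.
move=> U1; rewrite /sform big1 // => x xm.
have xU := subsetP (mins_sub U) _ xm.
have -> : U = [set x].
  by apply/esym/eqP; rewrite eqEcard sub1set xU cards1.
rewrite /adjop big1 ?mulr0 // => y /(subsetP (mins_sub _)).
by rewrite setDv inE.
Qed.

Lemma adjop_set2 (a b : X) w : a != b ->
  adjop [set a; b] w a = pull [set a; b] a w b.
Proof.
move=> nab; rewrite /adjop.
have -> : [set a; b] :\ a = [set b].
  apply/setP => x; rewrite !inE; case: (eqVneq x a) => //= ->.
  by rewrite (negbTE nab).
have -> : mins [set b] = [set b].
  apply/setP => x; apply/minsP/set1P => [[/set1P//]|->].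
  by split=> [|y /set1P->]; rewrite ?set11 ?ltxx.
by rewrite big_set1 setDv /nlin cards0 mul1r.
Qed.

Lemma sform_set2 (a b : X) v w : a != b -> sform [set a; b] v w =
  (if a \in mins [set a; b] then v a * pull [set a; b] a w b else 0)
  + (if b \in mins [set a; b] then v b * pull [set a; b] b w a else 0).
Proof.
move=> nab; have nba : b != a by rewrite eq_sym.
rewrite -(adjop_set2 _ nab) [in pull _ b _ _]setUC -(adjop_set2 _ nba).
rewrite [in adjop [set b; a]]setUC /sform.
rewrite (eq_bigl (fun x => (x \in [set a; b]) && (x \in mins [set a; b]))).
  by rewrite big_mkcondr big_setU1 ?in_set1 //= big_set1.
move=> x; case: (boolP (x \in mins _)) => [/(subsetP (mins_sub _))->//|].
by rewrite andbF.
Qed.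

(** For incomparable [a], [b] this is [4 * v a * v b <= (v a + v b) ^+ 2]; for a chain the form is
    the square of one weight and equality holds. *)
Lemma sform_hyperbolic_card2 U v : #|U| = 2%N ->
  sform U v v * sform U (fun=> 1) (fun=> 1) <= sform U v (fun=> 1) ^+ 2.
Proof.
move=> U2; case/cards2P: (introT eqP U2) => a [b [nab ->]].
rewrite !sform_set2 // /pull.
have := sqr_ge0 (v a - v b).
by case: (a \in mins _); case: (b \in mins _); lra.
Qed.

Lemma sform_hyperbolic_step U : (2 < #|U|)%N ->
    (forall x v, x \in mins U ->
       sform (U :\ x) v v * sform (U :\ x) (fun=> 1) (fun=> 1) <=
       sform (U :\ x) v (fun=> 1) ^+ 2) ->
  forall v, sform U v (fun=> 1) = 0 -> sform U v v <= 0.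
Proof.
move=> U2 IH v v0.
have cardD x k : x \in mins U -> (k.+1 < #|U|)%N -> (k < #|U :\ x|)%N.
  by move=> xm; rewrite (cardsD1 x U) (subsetP (mins_sub U) _ xm).
have deg x : x \in mins U ->
    \sum_(y in mins U) adj U x y = (nlin (U :\ x))%:R.
  move=> xm; rewrite -adjop1; last by rewrite -card_gt0 cardD // ltnW.
  by rewrite adjopE //; apply: eq_bigr => y _; rewrite mulr1.
rewrite sformE; apply: local_global.
- by move=> x y _ _; apply: adjC.
- by move=> x y _ _; apply: adj_ge0.
- move=> x y _ _ nxy; rewrite /adj eq_sym (negbTE nxy) ltr0n; exact: nlin_gt0.
- by move=> x xm; rewrite deg // ltr0n nlin_gt0.
- move=> u; rewrite -sformE; apply: le_trans (sform_pull u U2) _.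
  apply: ler_sum => x xm; rewrite deg // -adjopE //.
  rewrite ler_pdivlMr ?ltr0n ?nlin_gt0 //.
  have U1 : (1 < #|U :\ x|)%N by apply: cardD.
  rewrite -sform11 //; apply: le_trans (IH x _ xm) _.
  (* Pairing with the constant 1 turns the inner sums into [nlin (U :\ x :\ y)], which are the
     coefficients of [adjop U u x]. *)
  rewrite (_ : sform _ _ _ = adjop U u x) //.
  apply: eq_bigr => y ym; rewrite mulrC adjop1 //.
  rewrite -card_gt0; have := cardsD1 y (U :\ x).
  by rewrite (subsetP (mins_sub _) _ ym) => E; rewrite E in U1.
- rewrite -[RHS]v0 /sform; apply: eq_bigr => x xm.
  by rewrite deg // adjop1 1?mulrC // -card_gt0 cardD // ltnW.
Qed.

Lemma sform_hyperbolic U v :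
  sform U v v * sform U (fun=> 1) (fun=> 1) <= sform U v (fun=> 1) ^+ 2.
Proof.
have [n] := ubnP #|U|; elim: n U v => // n IHn U v ltU.
case: (ltngtP #|U| 2%N) => [U1|U2|]; last exact: sform_hyperbolic_card2.
  by rewrite !sform_card_le1 // mulr0 sqr_ge0.
have IH x u : x \in mins U ->
    sform (U :\ x) u u * sform (U :\ x) (fun=> 1) (fun=> 1) <=
    sform (U :\ x) u (fun=> 1) ^+ 2.
  move=> xm; apply: IHn; move: ltU; rewrite (cardsD1 x U).
  by rewrite (subsetP (mins_sub U) _ xm).
set q := sform U (fun=> 1) (fun=> 1).
have q_gt0 : 0 < q by rewrite /q sform11 ?ltr0n ?nlin_gt0 // ltnW.
set s := sform U v (fun=> 1).
(* The projection of [v] to the orthogonal of 1, scaled by [q]; its form value is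
   [q * (q * sform U v v - s ^+ 2)]. *)
pose u x := q * v x + (- s) * 1.
have u0 : sform U u (fun=> 1) = 0 by rewrite sform_linear -/q -/s; ring.
have := sform_hyperbolic_step U2 IH u0.
rewrite sform_linear [X in _ + _ * X]sformC u0 mulr0 addr0 sformC.
rewrite sform_linear [sform U (fun=> 1) v]sformC -/s.
by rewrite pmulr_rle0 //; lra.
Qed.

(** The combination of [v] and [w] orthogonal to 1 has nonpositive form value, and completing the
    square yields the claim. Positivity at [w] and at 1 keeps the coefficient [b] of [v] nonzero. *)
Lemma sform_reverse_CS U v w : 0 < sform U w w ->
  0 < sform U (fun=> 1) (fun=> 1) ->
  sform U v v * sform U w w <= sform U v w ^+ 2.
Proof.
move=> w_gt0 q_gt0.
set a := sform U v (fun=> 1); set b := sform U w (fun=> 1).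
have b2_gt0 : 0 < b ^+ 2.
  by apply: lt_le_trans (sform_hyperbolic U w); apply: mulr_gt0.
pose u x := b * v x + (- a) * w x.
have u0 : sform U u (fun=> 1) = 0 by rewrite sform_linear -/a -/b; ring.
have := sform_hyperbolic U u; rewrite u0 expr0n pmulr_lle0 //=.
rewrite sform_linear ![sform U _ u]sformC !sform_linear [sform U w v]sformC.
set vv := sform U v v; set ww := sform U w w; set vw := sform U v w => h.
rewrite -subr_le0 -(pmulr_rle0 _ b2_gt0).
have -> : b ^+ 2 * (vv * ww - vw ^+ 2) =
    ww * (b * (b * vv + - a * vw) + - a * (b * vw + - a * ww))
    - (a * ww - b * vw) ^+ 2 by ring.
have : ww * (b * (b * vv + - a * vw) + - a * (b * vw + - a * ww)) <= 0.
  by rewrite pmulr_rle0.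
by have := sqr_ge0 (a * ww - b * vw); lra.
Qed.

End Forms.

(** * Counting linear extensions with a given initial segment *)

Section Counting.

Context {d : Order.disp_t} {X : finPOrderType d}.
Implicit Types (f : labelling X) (s : seq X) (x y : X) (S U : {set X}).

Lemma linextP f : reflect
  [/\ injective f, forall k : 'I_#|X|, exists x, f x = k
    & forall x y, (x < y)%O -> (f x < f y)%N] (f \in linexts X).
Proof.
rewrite inE /is_linext; apply: (iffP and3P) => -[inj surj mono]; split.
- exact/injectiveP.
- by move=> k; have /existsP[x /eqP] := forallP surj k; exists x.
- by move=> x y; apply/implyP; move/forallP/(_ x)/forallP: mono; apply.
- exact/injectiveP.
- by apply/forallP => k; have [x <-] := surj k; apply/existsP; exists x.
- by apply/forallP => x; apply/forallP => y; apply/implyP; apply: mono.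
Qed.

Definition prefixed s : {set labelling X} :=
  [set f in linexts X | all (fun x => f x == index x s :> nat) s].

Definition rest s : {set X} := ~: [set x in s].

(** These are the sequences with which some linear extension begins. *)
Definition closed_prefix s := uniq s /\
  forall x y, (x < y)%O -> y \in s -> x \in s /\ (index x s < index y s)%N.

Lemma rest_rcons s x : rest (rcons s x) = rest s :\ x.
Proof. by apply/setP => y; rewrite !inE mem_rcons inE negb_or. Qed.

Lemma rest_nil : rest [::] = setT.
Proof. by apply/setP => y; rewrite !inE. Qed.

Lemma card_rest s : uniq s -> (#|rest s| + size s)%N = #|X|.
Proof.
move=> us; have -> : size s = #|[set x in s]|.
  by rewrite cardsE; apply/esym/card_uniqP.
by rewrite addnC cardsC.
Qed.

Lemma index_rcons_mem s x y : y \in s -> index y (rcons s x) = index y s.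
Proof. by move=> ys; rewrite -cats1 index_cat ys. Qed.

Lemma index_rcons_last s x : x \notin s -> index x (rcons s x) = size s.
Proof. by move=> /negbTE xs; rewrite -cats1 index_cat xs /= eqxx addn0. Qed.

Lemma closed_prefix_rcons s x :
  closed_prefix s -> x \in mins (rest s) -> closed_prefix (rcons s x).
Proof.
move=> [us cl] /minsP[]; rewrite !inE => xs xm; split.
  by rewrite rcons_uniq xs.
move=> u y uy; rewrite mem_rcons inE => /orP[/eqP yx|ys].
  have uS : u \in s.
    by apply: contraTT uy => us'; rewrite yx xm // !inE.
  rewrite mem_rcons inE uS orbT yx index_rcons_last // index_rcons_mem //.
  by rewrite index_mem.
by have [uS ?] := cl _ _ uy ys; rewrite mem_rcons inE uS orbT !index_rcons_mem.
Qed.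

Lemma prefixed_rcons s x f : x \notin s ->
  (f \in prefixed (rcons s x)) = (f \in prefixed s) && (f x == size s :> nat).
Proof.
move=> xs; rewrite [in LHS]inE [in f \in prefixed s]inE -andbA; congr (_ && _).
rewrite all_rcons index_rcons_last // andbC; congr (_ && _).
by apply: eq_in_all => y ys; rewrite index_rcons_mem.
Qed.

Lemma prefixed_next s f x : closed_prefix s -> f \in prefixed s ->
  f x = size s :> nat -> x \in mins (rest s).
Proof.
move=> [us cl]; rewrite inE => /andP[/linextP[inj surj mono] /allP fs] fx.
(* Labels start at 0, so [s] occupies exactly the labels below [size s], and everything below [x]
   must lie in [s]. *)
have lt_s y : (y \in s) = (f y < size s)%N.
  apply/idP/idP => [ys|lt]; first by rewrite (eqP (fs y ys)) index_mem.
  have ys : nth y s (f y) \in s by rewrite mem_nth.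
  have := fs _ ys; rewrite index_uniq // => /eqP/val_inj/inj E.
  by rewrite -E.
apply/minsP; rewrite !inE lt_s fx ltnn; split=> // y.
by rewrite !inE lt_s -fx; apply: contra; apply: mono.
Qed.

Lemma big_prefixed (F : labelling X -> nat) s :
    closed_prefix s -> (size s < #|X|)%N ->
  (\sum_(f in prefixed s) F f =
   \sum_(x in mins (rest s)) \sum_(f in prefixed (rcons s x)) F f)%N.
Proof.
move=> cs lt_s.
(* The inner sum has one nonzero candidate: the unique element with label [size s]. *)
transitivity (\sum_(f in prefixed s) \sum_(x in mins (rest s))
    if f x == size s :> nat then F f else 0)%N.
  apply: eq_bigr => f fs; have := fs; rewrite inE.
  case/andP => /linextP[inj surj _] _; have [x fx] := surj (Ordinal lt_s).
  have fxs : f x = size s :> nat by rewrite fx.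
  rewrite (bigD1 x) /=; last exact: prefixed_next fxs.
  rewrite fxs eqxx big1 ?addn0 // => y /andP[_ yx].
  case: eqP => // fy; case/eqP: yx; apply: inj; apply: val_inj.
  by rewrite /= fy fxs.
rewrite exchange_big; apply: eq_bigr => x /minsP[]; rewrite !inE => xs _.
rewrite -big_mkcondr; apply: eq_bigl => f; by rewrite prefixed_rcons.
Qed.

Lemma prefixed_full s : closed_prefix s -> size s = #|X| -> #|prefixed s| = 1%N.
Proof.
move=> [us cl] sz.
have ins x : x \in s.
  have := card_rest us; rewrite sz -[RHS]add0n => /eqP; rewrite eqn_add2r.
  by rewrite cards_eq0 => /eqP/setP/(_ x); rewrite !inE => /negbFE.
have ltx x : (index x s < #|X|)%N by rewrite -sz index_mem.
pose f0 : labelling X := [ffun x => Ordinal (ltx x)].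
have f0E x : f0 x = index x s :> nat by rewrite ffunE.
apply/eqP/cards1P; exists f0; apply/setP => f; rewrite !inE -/(is_linext f).
apply/andP/eqP => [[_ /allP fs]|->].
  by apply/ffunP => x; apply: val_inj; rewrite /= f0E; apply/eqP/fs.
split; last by apply/allP => x _; rewrite f0E.
have : f0 \in linexts X; last by rewrite inE.
apply/linextP; split.
- move=> x y /(congr1 val) /=; rewrite !f0E => E.
  by rewrite -(nth_index x (ins x)) E nth_index.
- move=> k; exists (nth (enum_val k) s k); apply: val_inj.
  by rewrite /= f0E index_uniq // sz.
- by move=> x y xy; rewrite !f0E; have [] := cl _ _ xy (ins y).
Qed.

(** Both sides satisfy the same recursion over the next element. *)
Lemma card_prefixed s : closed_prefix s -> #|prefixed s| = nlin (rest s).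
Proof.
have [n] := ubnP #|rest s|; elim: n s => // n IHn s lt_n cs.
have := card_rest cs.1; case: (posnP #|rest s|) => [r0|r_gt0] cX.
  have sz : size s = #|X| by rewrite -cX r0.
  by rewrite prefixed_full // /nlin r0.
rewrite -sum1_card big_prefixed //; last by rewrite -cX -[X in (X < _)%N]add0n ltn_add2r.
rewrite nlin_mins -?card_gt0 //; apply: eq_bigr => x xm.
rewrite sum1_card IHn ?rest_rcons //; last exact: closed_prefix_rcons.
move: lt_n; rewrite (cardsD1 x) (subsetP (mins_sub _) _ xm) add1n.
by rewrite ltnS.
Qed.

Lemma mem_flabels f S x :
  injective f -> ((f x).+1 \in flabels f S) = (x \in S).
Proof.
move=> inj; rewrite /flabels mem_image //.
by move=> y z [] /val_inj /inj.
Qed.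

Lemma card_first_second S1 S2 : (1 < #|X|)%N ->
  (#|[set f in linexts X | (1%N \in flabels f S1) && (2%N \in flabels f S2)]|%:R
   = \sum_(x in mins setT) (x \in S1)%:R *
     \sum_(y in mins (setT :\ x)) (nlin (setT :\ x :\ y))%:R * (y \in S2)%:R :> rat).
Proof.
move=> X1; have c0 : closed_prefix [::] by split.
have E0 : prefixed [::] = linexts X by apply/setP => f; rewrite inE andbT.
rewrite -sum1_card (eq_bigl (fun f => (f \in prefixed [::]) &&
  ((1%N \in flabels f S1) && (2%N \in flabels f S2)))); last first.
  by move=> f; rewrite [in LHS]inE E0.
rewrite big_mkcondr big_prefixed //=; last exact: ltnW.
rewrite natr_sum rest_nil; apply: eq_bigr => x xm.
have c1 : closed_prefix [:: x].
  by apply: (closed_prefix_rcons c0); rewrite rest_nil.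
have r1 : rest [:: x] = setT :\ x by rewrite -rest_nil -rest_rcons.
rewrite big_prefixed //= natr_sum r1 mulr_sumr; apply: eq_bigr => y ym.
have c2 : closed_prefix [:: x; y].
  by apply: (closed_prefix_rcons c1); rewrite r1.
have r2 : rest [:: x; y] = setT :\ x :\ y by rewrite -r1 -rest_rcons.
rewrite -r2 -card_prefixed // (eq_bigr (fun=> (x \in S1) && (y \in S2) : nat)).
  rewrite sum_nat_const natrM mulrCA; congr (_ * _).
  by case: (x \in S1); case: (y \in S2); rewrite ?mulr0 ?mulr1.
move=> f; rewrite inE => /andP[/linextP[inj _ _]] /=; rewrite !eqxx.
have xy : x != y by move: c2.1; rewrite /= inE => /andP[].
rewrite (negbTE xy) andbT => /andP[/eqP fx /eqP fy].
have := mem_flabels S1 x inj; rewrite fx => ->.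
have := mem_flabels S2 y inj; rewrite fy => ->.
by case: (_ && _).
Qed.

End Counting.

(** * Evaluation of the form at the indicators of [A] and [B] *)

Theorem theorem1p9 (d : Order.disp_t) (X : finPOrderType d) (A B : {set X})
    (hAmin : A \subset minimals X) (hBmin : B \subset minimals X)
    (hAB : [disjoint A & B]) (hA : A != set0) (hB : B != set0) :
  (Pr (fun f : labelling X => (1%N \in flabels f A) && (2%N \in flabels f (up_closure A)))
   * Pr (fun f : labelling X => (1%N \in flabels f B) && (2%N \in flabels f (up_closure B)))
   <= Pr (fun f : labelling X => (1%N \in flabels f A) && (2%N \in flabels f B)) ^+ 2)%R.
Proof.
have minsT : mins setT = minimals X.
  apply/setP => x; rewrite !inE; apply/forallP/forallP => h y.
    by have := h y; rewrite inE.
  by rewrite inE; apply: h.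
have X1 : (1 < #|X|)%N.
  case/set0Pn: hA => a aA; case/set0Pn: hB => b bB.
  have nab : a != b by apply: contraTneq bB => <-; rewrite (disjointFr hAB).
  by have := max_card [set a; b]; rewrite cards2 nab.
pose ind (S : {set X}) x : rat := (x \in S)%:R.
(* A minimal second element lies in [up_closure S] only if it is in [S]; a nonminimal one is above
   the first element [x], hence in [up_closure S] when [x] is in [S], matching the inherited
   weight. *)
have cup (S : {set X}) : S \subset minimals X ->
    #|[set f in linexts X | (1%N \in flabels f S)
        && (2%N \in flabels f (up_closure S))]|%:R
    = sform setT (ind S) (ind S).
  move=> Smin; rewrite card_first_second //; apply: eq_bigr => x xm.
  rewrite /ind; case: (boolP (x \in S)) => xS; last by rewrite !mul0r.
  congr (_ * _); apply: eq_bigr => y /minsP[_ ym]; congr (_ * _).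
  rewrite /pull; case: (boolP (y \in mins setT)) => [/minsP[_ yT]|].
    congr (_ : bool)%:R; rewrite inE.
    apply/exists_inP/idP => [[t tS]|yS]; last by exists y.
    by rewrite le_eqVlt (negbTE (yT t _)) ?inE // orbF => /eqP <-.
  rewrite inE in_setT negb_forall_in => /existsP[t /andP[_]].
  rewrite negbK => ty; rewrite xS inE (_ : [exists _ in _, _]) //.
  apply/exists_inP; exists x => //; suff <- : t = x by apply: ltW.
  by apply: contraTeq ty => tx; apply: ym; rewrite !inE tx.
have cAB : #|[set f in linexts X | (1%N \in flabels f A)
        && (2%N \in flabels f B)]|%:R = sform setT (ind A) (ind B).
  rewrite card_first_second //; apply: eq_bigr => x xm.
  rewrite /ind; case: (boolP (x \in A)) => xA; last by rewrite !mul0r.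
  congr (_ * _); apply: eq_bigr => y _; congr (_ * _).
  (* A nonminimal second element inherits weight 0 from [x], as [x] is not in [B], and is itself
     outside [B]. *)
  rewrite /pull (disjointFr hAB xA); case: ifP => //; rewrite minsT => ynm.
  have -> // : (y \in B) = false.
  by apply: contraFF ynm => /(subsetP hBmin).
rewrite /Pr cAB !cup // mulrACA expr_div_n -expr2 -exprVn.
apply: ler_wpM2r; first by rewrite exprn_ge0 // invr_ge0.
have : 0 <= sform setT (ind B) (ind B) by rewrite -cup.
(* If the form vanishes at the indicator of [B], the left side is 0; otherwise the reverse
   Cauchy-Schwarz inequality applies. *)
rewrite le_eqVlt => /predU1P[<-|B_gt0]; first by rewrite mulr0 sqr_ge0.
by apply: sform_reverse_CS => //; rewrite sform11 ?cardsT // ltr0n nlin_gt0.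
Qed.
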